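(* Let $X_1\sim F_1$, $X_2\sim F_2$ be two nonnegative, continuous and strictly DGMRD demand distributions with finite second moments, and let $r_1^*,r_2^*$ be the supplier's optimal wholesale prices in markets $X_1$ and $X_2$, respectively. If market $X_2$ is less elastic than market $X_1$, then $r_1^*\le r_2^*$.
   Context: For a nonnegative random variable $X$ with continuous (non-atomic) cdf $F$, $F(0)=0$, finite mean, $\bar F:=1-F$ and $H=\inf\{r\ge0:F(r)=1\}\in(0,\infty]$, the mean residual demand (MRD) function is $\mathrm{m}(r):=\mathbb{E}(X-r\mid X>r)=\frac{1}{\bar F(r)}\int_r^\infty\bar F(u)\,du$ for $r<H$ and $\mathrm{m}(r):=0$ otherwise. The generalized mean residual demand (GMRD) function is $\ell(r):=\mathrm{m}(r)/r$, $0<r<H$. $X$ is (strictly) DGMRD if $\ell$ is (strictly) decreasing on $(0,H)$. The supplier's optimal wholesale price in market $X$ is the maximizer $r^*$ of $r\,\mathbb{E}(X-r)_+$ over $r\ge0$, where $(x)_+=\max\{0,x\}$; for strictly DGMRD $X$ with finite second moment it exists and is the unique solution of $r=\mathrm{m}(r)$. The price elasticity of expected demand is $\varepsilon(r)=-r\,\frac{d}{dr}\mathbb{E}(X-r)_+\big/\mathbb{E}(X-r)_+=r/\mathrm{m}(r)$. With subscripts $i=1,2$ referring to $X_i$, market $X_2$ is said to be less elastic than market $X_1$ if $\varepsilon_2(r)\le\varepsilon_1(r)$ for every $r\ge0$; this is understood as equivalent to $X_1$ being smaller than $X_2$ in the mean residual demand order, i.e. $\mathrm{m}_1(r)\le\mathrm{m}_2(r)$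 for all $r\ge0$. *)

(* Defs.v *)
From HB Require Import structures.
From mathcomp Require Import all_boot all_order all_algebra.
From mathcomp Require Import all_classical all_reals all_analysis.

Set Implicit Arguments.
Unset Strict Implicit.
Unset Printing Implicit Defensive.

Import Order.TTheory GRing.Theory Num.Theory.
Import numFieldNormedType.Exports.

Local Open Scope classical_set_scope.
Local Open Scope ring_scope.

Section demand.
Context {d : measure_display} {T : measurableType d} {R : realType}
  {P : probability T R}.

(* Elementary conditional expectation E(Y | A) = E(Y 1_A) / P(A); only
   meaningful when P A > 0 and Y is integrable on A. *)
Definition cond_expectation (Y : T -> R) (A : set T) : R :=
  fine (\int[P]_(x in A) (Y x)%:E)%E / fine (P A).

Variable X : {RV P >-> R}.

Record continuous_demand : Prop := {
  demand_ge0 : {ae P, forall t, 0 <= X t};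
  demand_cdf_continuous : continuous (cdf X);
  demand_cdf0 : cdf X 0 = 0%E;
  demand_finite_mean : P.-integrable setT (EFin \o X) }.

(* H = inf {r >= 0 : F(r) = 1}, equal to +oo when the set is empty. *)
Definition upper_end : \bar R :=
  ereal_inf [set r%:E | r in [set r : R | 0 <= r /\ cdf X r = 1%E]].

Definition mrd (r : R) : R :=
  if (r%:E < upper_end)%E
  then cond_expectation (fun t => X t - r) [set t | r < X t]
  else 0.

Definition gmrd (r : R) : R := mrd r / r.

Definition strictly_DGMRD : Prop :=
  forall r s : R, 0 < r -> r < s -> (s%:E < upper_end)%E -> gmrd s < gmrd r.

Definition expected_demand (r : R) : R :=
  fine ('E_P[fun t => (Num.max 0 (X t - r))%R])%E.

Definition optimal_price (r : R) : Prop :=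
  0 <= r /\
  forall s : R, 0 <= s -> s * expected_demand s <= r * expected_demand r.

(* For r >= H the expected demand vanishes and the quotient is 0/0; its value
   is +oo there, following epsilon(r) = r / m(r) with m(r) = 0.  With this
   convention epsilon_2 <= epsilon_1 on [0, +oo) is equivalent to m_1 <= m_2
   on [0, +oo). *)
Definition elasticity (r : R) : \bar R :=
  if (r%:E < upper_end)%E
  then (- r * derive1 expected_demand r / expected_demand r)%:E
  else +oo%E.

End demand.

Definition less_elastic (R : realType)
    (d2 : measure_display) (T2 : measurableType d2) (P2 : probability T2 R)
    (X2 : {RV P2 >-> R})
    (d1 : measure_display) (T1 : measurableType d1) (P1 : probability T1 R)
    (X1 : {RV P1 >-> R}) : Prop :=
  forall r : R, 0 <= r -> (elasticity X2 r <= elasticity X1 r)%E.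

(* Main.v *)
(* Write g_i(r) = E(X_i - r)_+ and S_i = 1 - F_i.  Since -S_i is a continuous
   subgradient of g_i, it is its derivative, so eps_i = r S_i / g_i, and the
   optimality of r_i for r g_i(r) forces eps_i(r_i) = 1.  Hence
   eps_2(r_1) <= eps_1(r_1) = 1 = eps_2(r_2), whereas r_2 < r_1 would make
   eps_2(r_1) > eps_2(r_2) because m_2(r) / r = 1 / eps_2(r) is strictly
   decreasing. *)
Require Import Defs.
From HB Require Import structures.
From mathcomp Require Import all_boot all_order all_algebra.
From mathcomp Require Import all_classical all_reals all_analysis.
From mathcomp Require Import measurable_realfun ring lra.

Import Order.TTheory GRing.Theory Num.Theory.
Import numFieldNormedType.Exports.

Local Open Scope classical_set_scope.
Local Open Scope ring_scope.

(** The inequality used from [r] and from [r + h] gives [s r * h <= g (r + h) - g r <= s (r + h) *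
    h], so for either sign of [h] the difference quotient is within [|s (r + h) - s r|] of [s r]. *)
Lemma is_derive_subgradient (R : realFieldType) (g s : R -> R) (r : R) :
  (forall x y, g x + s x * (y - x) <= g y) -> {for r, continuous s} ->
  is_derive r 1 g (s r).
Proof.
move=> sub cs.
have sr : (s (h *: 1 + r) : R) @[h --> (0 : R)^'] --> (s r : R).
  have cv : (h *: 1 + r : R) @[h --> (0 : R)^'] --> (r : R).
    rewrite -[X in _ --> X]add0r; apply: cvgD; last exact: cvg_cst.
    rewrite -[X in _ --> X](scale0r (1 : R)); apply: cvgZr_tmp.
    exact: nbhs_dnbhs.
  exact: (cvg_comp _ _ cv cs).
have d0 : ((s (h *: 1 + r) - s r : R)) @[h --> (0 : R)^'] --> (0 : R).
  by rewrite -[X in _ --> X](subrr (s r)); apply: cvgB => //; exact: cvg_cst.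
have dq : h^-1 *: ((g \o shift r) (h *: 1) - g r) @[h --> (0 : R)^'] --> s r.
  apply: (@squeeze_cvgr _ _ _ _
    (fun h => s r - `|s (h *: 1 + r) - s r|)
    (fun h => s r + `|s (h *: 1 + r) - s r|)).
  - near=> h.
    have h0 : h != 0 by near: h; exact: nbhs_dnbhs_neq.
    rewrite -ler_distl.
    have -> : h^-1 *: ((g \o shift r) (h *: 1) - g r) - s r =
        h^-1 * (g (h *: 1 + r) - g r - s r * h).
      by rewrite /= /GRing.scale /=; field.
    rewrite normrM normfV ler_pdivrMl ?normr_gt0// mulrC -normrM.
    have /= := sub r (h *: 1 + r); have /= := sub (h *: 1 + r) r.
    rewrite /GRing.scale /= mulr1 => A B.
    rewrite ger0_norm; last lra.
    by have := ler_norm (h * (s (h + r) - s r)); lra.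
  - rewrite -[X in _ --> X]subr0; apply: cvgB; first exact: cvg_cst.
    by rewrite -[X in _ --> X](normr0 R); exact: cvg_norm d0.
  - rewrite -[X in _ --> X]addr0; apply: cvgD; first exact: cvg_cst.
    by rewrite -[X in _ --> X](normr0 R); exact: cvg_norm d0.
by apply: DeriveDef; [apply: cvgP dq|exact: cvg_lim].
Unshelve. all: by end_near.
Qed.

Section demand_theory.
Context {d : measure_display} {T : measurableType d} {R : realType}
  {P : probability T R} (X : {RV P >-> R}) (hX : continuous_demand X).

Definition tail (r : R) : R := fine (ccdf X r).

Lemma tail_cdf r : tail r = 1 - fine (cdf X r).
Proof. by rewrite /tail ccdf_1_cdf fineB// fin_num_measure. Qed.

Lemma tail_ge0 r : 0 <= tail r.
Proof. exact: fine_ge0. Qed.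

Lemma cdf_eq1 r : (cdf X r = 1%E) <-> tail r = 0.
Proof.
rewrite tail_cdf -[in X in X <-> _](@fineK _ (cdf X r)) ?fin_num_measure//.
by split=> [[->]|/subr0_eq <-//]; rewrite subrr.
Qed.

Lemma tail_continuous : continuous tail.
Proof.
move=> r; rewrite (funext tail_cdf).
apply: cvgB; first exact: cvg_cst.
apply: fine_cvg; rewrite fineK ?fin_num_measure//.
exact: demand_cdf_continuous hX r.
Qed.

(** Continuity of the cdf leaves room to the right of [r]; this room is the source of the strict
    inequalities below. *)
Lemma tail_gt0_right r : 0 < tail r -> exists2 s, r < s & 0 < tail s.
Proof.
move=> r0.
have /nbhs_ballP[e /= e0 he] : \forall x \near r, 0 < tail x.
  exact: cvgr_gt (tail_continuous r) _ r0.
exists (r + e / 2); first by rewrite ltrDl divr_gt0.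
by apply: he; rewrite /ball/= opprD addrA subrr sub0r normrN gtr0_norm; lra.
Qed.

Lemma tail0 : tail 0 = 1.
Proof. by rewrite tail_cdf (demand_cdf0 hX) subr0. Qed.

Lemma lt_upper_end r : 0 <= r -> (r%:E < upper_end X)%E <-> 0 < tail r.
Proof.
move=> r0; split=> [rH|].
  rewrite lt_neqAle tail_ge0 andbT eq_sym; apply/eqP => /cdf_eq1 r1.
  by move: rH; rewrite ltNge ereal_inf_lbound//; exists r.
(* A lower bound of the set only bounds its infimum weakly, hence the detour through [s > r]: by
   monotonicity every [u] with [F(u) = 1] lies above [s]. *)
case/tail_gt0_right => s rs s0; apply: (@lt_le_trans _ _ s%:E) => //.
apply: le_ereal_inf_tmp => _ [u [_ u1] <-]; rewrite lee_fin leNgt.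
apply/negP => /ltW /(cdf_nondecreasing X); rewrite u1 => s1.
have /cdf_eq1 st : cdf X s = 1%E by apply/eqP; rewrite eq_le s1 cdf_le1.
by rewrite st ltxx in s0.
Qed.

Lemma integrable_excess r :
  P.-integrable setT (EFin \o (fun t => Num.max 0 (X t - r))).
Proof.
have iX := integrableB measurableT (demand_finite_mean hX)
  (finite_measure_integrable_cst P r measurableT).
apply: le_integrable iX => //.
  by apply/measurable_EFinP/measurable_maxr => //; exact: measurable_funB.
move=> t _ /=; rewrite lee_fin ger0_norm ?le_max ?lexx//.
by rewrite ge_max normr_ge0 ler_norm.
Qed.

Lemma expected_demandE r :
  expected_demand X r = \int[P]_t Num.max 0 (X t - r).
Proof. by rewrite /expected_demand unlock. Qed.

(* Pointwise, [(X - s)_+ >= (X - r)_+ - 1_{X > r} (s - r)]. *)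
Lemma expected_demand_subgradient r s :
  expected_demand X r - tail r * (s - r) <= expected_demand X s.
Proof.
have mA : measurable (X @^-1` `]r, +oo[).
  by rewrite -[X in measurable X]setTI; exact: measurable_funP.
have iA := integrable_indic P mA.
rewrite !expected_demandE.
have -> : tail r * (s - r) =
    \int[P]_t (\1_(X @^-1` `]r, +oo[) t * (s - r)).
  rewrite RintegralZr//; congr (_ * _).
  by rewrite /Rintegral integral_indic// setIT.
have iAs : P.-integrable setT
    (EFin \o (fun t => \1_(X @^-1` `]r, +oo[) t * (s - r))).
  exact: (integrableZr measurableT (s - r) iA).
rewrite -RintegralB//; last exact: integrable_excess.
apply: le_Rintegral => //.
- exact: (integrableB measurableT (integrable_excess r) iAs).
- exact: integrable_excess.
move=> t _; rewrite indicE.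
case: (ltP r (X t)) => rX.
  rewrite mem_set/=; last by rewrite in_itv/= rX.
  rewrite mul1r max_r; last lra.
  by rewrite le_max; apply/orP; right; lra.
rewrite memNset/=; last by rewrite in_itv/= andbT; apply/negP; rewrite -leNgt.
by rewrite mul0r subr0 max_l ?le_max ?lexx//; lra.
Qed.

Lemma expected_demand_ge0 r : 0 <= expected_demand X r.
Proof.
rewrite expected_demandE; apply: Rintegral_ge0 => t _.
by rewrite le_max lexx.
Qed.

(** The subgradient at some [s > r] with positive tail bounds the value at [r] below by
    [tail s * (s - r) > 0]. *)
Lemma expected_demand_gt0 r : 0 < tail r -> 0 < expected_demand X r.
Proof.
case/tail_gt0_right => s rs s0.
have := expected_demand_subgradient s r.
by have := expected_demand_ge0 s; nra.
Qed.

Lemma derive1_expected_demand r : derive1 (expected_demand X) r = - tail r.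
Proof.
rewrite derive1E; apply: derive_val.
apply: (@is_derive_subgradient _ _ (fun r => - tail r)) => [x y|].
  by rewrite mulNr; exact: expected_demand_subgradient.
by apply: cvgN; exact: tail_continuous.
Qed.

(** The positive part vanishes off [{X > r}] and equals [X - r] on it, so it has the same integral
    as the conditional expectation's numerator. The quotient is shaped as the reciprocal of the
    elasticity. *)
Lemma gmrdE r : 0 < r -> 0 < tail r ->
  gmrd X r = expected_demand X r / (r * tail r).
Proof.
move=> r0 tr; rewrite /gmrd /mrd (iffRL (lt_upper_end _ (ltW r0)) tr).
have AE : [set t | r < X t] = X @^-1` `]r, +oo[.
  by apply/seteqP; split=> t /=; rewrite in_itv/= andbT.
have -> : cond_expectation (P := P) (fun t => X t - r) [set t | r < X t] =
    expected_demand X r / tail r.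
  rewrite /cond_expectation AE; congr (_ / _).
  rewrite expected_demandE [LHS]Rintegral_mkcond.
  apply: eq_Rintegral => t _; rewrite patchE; case: ifPn.
    by move/set_mem; rewrite /= in_itv/= andbT => rX; rewrite max_r//; lra.
  rewrite notin_setE /= in_itv/= andbT => /negP; rewrite -leNgt => rX.
  by rewrite max_l//; lra.
by rewrite invfM mulrA mulrAC.
Qed.

Lemma elasticityE r : 0 <= r -> 0 < tail r ->
  elasticity X r = (r * tail r / expected_demand X r)%:E.
Proof.
move=> r0 tr; rewrite /elasticity (iffRL (lt_upper_end _ r0) tr).
by rewrite derive1_expected_demand mulrNN.
Qed.

Lemma optimal_price_first_order r : optimal_price X r ->
  [/\ 0 < r, 0 < tail r & expected_demand X r = r * tail r].
Proof.
move=> [r0 opt].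
(* Since [tail 0 = 1], some positive price earns positive revenue, so the optimal revenue is
   positive; this excludes [r = 0]. *)
have [s s0 ts] : exists2 s, 0 < s & 0 < tail s.
  by apply: tail_gt0_right; rewrite tail0.
have rg : 0 < r * expected_demand X r.
  by apply: lt_le_trans (opt _ (ltW s0)); rewrite mulr_gt0// expected_demand_gt0.
have rp : 0 < r.
  by rewrite lt_neqAle r0 andbT; apply: contraTneq rg => <-; rewrite mul0r ltxx.
have gp : 0 < expected_demand X r by rewrite pmulr_rgt0 in rg.
(* Optimality and the subgradient at [r] give [u * (g r - tail r * (u - r)) <= u * g u <= r * g r],
   with [g] the expected demand; the difference of the outer terms factors. *)
have key u : 0 <= u -> (u - r) * (expected_demand X r - u * tail r) <= 0.
  move=> u0; have := opt _ u0.
  have := ler_wpM2l u0 (expected_demand_subgradient r u).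
  by move=> A B; have := le_trans A B; lra.
have tp : 0 < tail r.
  rewrite lt_neqAle tail_ge0 andbT; apply/eqP => t0.
  by have := key (r + 1); rewrite -t0 mulr0 subr0 => /(_ ltac:(lra)); lra.
split=> //.
(* Test optimality at the midpoint of [r] and [m(r)]. *)
set m := expected_demand X r / tail r.
have gE : expected_demand X r = m * tail r by rewrite /m divfK ?gt_eqF.
have m0 : 0 < m by exact: divr_gt0.
have := key ((r + m) / 2); rewrite gE => /(_ ltac:(lra)).
rewrite -mulrBl mulrA pmulr_lle0// => sq.
(* At the midpoint both factors in [sq] equal [(m - r) / 2]. *)
have /eqP : (m - r) ^+ 2 = 0 by apply/eqP; rewrite eq_le sqr_ge0 andbT; lra.
by rewrite sqrf_eq0 subr_eq0 => /eqP ->.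
Qed.

End demand_theory.

Theorem lemma4p2 (R : realType)
  (d1 d2 : measure_display) (T1 : measurableType d1) (T2 : measurableType d2)
  (P1 : probability T1 R) (P2 : probability T2 R)
  (X1 : {RV P1 >-> R}) (X2 : {RV P2 >-> R})
  (hX1 : continuous_demand X1) (hX2 : continuous_demand X2)
  (dgmrd1 : strictly_DGMRD X1) (dgmrd2 : strictly_DGMRD X2)
  (moment1 : ('E_P1[fun t => (X1 t ^+ 2)%R] < +oo)%E)
  (moment2 : ('E_P2[fun t => (X2 t ^+ 2)%R] < +oo)%E)
  (r1 r2 : R) (opt1 : optimal_price X1 r1) (opt2 : optimal_price X2 r2)
  (hle : less_elastic X2 X1) :
  r1 <= r2.
Proof.
have [r1p t1 g1] := optimal_price_first_order X1 hX1 _ opt1.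
have [r2p t2 g2] := optimal_price_first_order X2 hX2 _ opt2.
rewrite leNgt; apply/negP => r21.
have := hle _ (ltW r1p); rewrite (elasticityE X1 hX1 _ (ltW r1p) t1).
rewrite g1 divff ?gt_eqF ?mulr_gt0// => el2.
(* The elasticity is [+oo] from the upper end on, so the bound by 1 keeps [r1] below the upper end
   of [X2], where strict monotonicity of [gmrd X2] applies. *)
have r1H : (r1%:E < upper_end X2)%E.
  by move: el2; rewrite /elasticity; case: ifP.
have t21 := iffLR (lt_upper_end X2 hX2 _ (ltW r1p)) r1H.
have g21 := expected_demand_gt0 X2 hX2 _ t21.
have := dgmrd2 _ _ r2p r21 r1H.
(* As [gmrd X2 r2 = 1], this reads [expected_demand X2 r1 < r1 * tail r1], the negation of [el2]. *)
rewrite !(gmrdE X2 hX2)// g2 divff ?gt_eqF ?mulr_gt0// ltr_pdivrMr ?mulr_gt0//.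
move: el2; rewrite (elasticityE X2 hX2 _ (ltW r1p) t21) lee_fin
  ler_pdivrMr// !mul1r.
by rewrite leNgt => /negP.
Qed.
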